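(* Let $D(0;1)=\{z\in\mathbb{C}:|z|<1\}$ and let $f:D(0;1)\to\mathbb{C}$ be analytic. Then there exists a sequence $(a_j)_{j\ge 0}$ of complex numbers such that $$f(z)=\sum_{j=0}^{+\infty}a_jz^j\quad\text{for all } z\in D(0;1).$$
   Context: A function $f:\Omega\to\mathbb{C}$ on an open set $\Omega\subset\mathbb{C}$ is analytic if for each $z_0\in\Omega$ there exist a radius $r=r(z_0)>0$ and constants $c_n\in\mathbb{C}$ such that $D(z_0;r)=\{z:|z-z_0|<r\}\subset\Omega$ and $f(z)=\sum_{n=0}^{+\infty}c_n(z-z_0)^n$ for all $z\in D(z_0;r)$ (only this local power series property is assumed). *)

(* Defs.v *)
From Stdlib Require Import Reals.
From Coquelicot Require Import Coquelicot.

Local Open Scope C_scope.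

Definition Cdisc (z0 : C) (r : R) (z : C) : Prop := (Cmod (z - z0) < r)%R.

(* A function defined on [Omega] is encoded as a total function on [C];
   only its values on [Omega] matter. *)
Definition analytic_on (Omega : C -> Prop) (f : C -> C) : Prop :=
  open Omega /\
  forall z0 : C, Omega z0 ->
    exists (r : R) (c : nat -> C),
      (0 < r)%R /\
      (forall z : C, Cdisc z0 r z -> Omega z) /\
      (forall z : C, Cdisc z0 r z -> is_pseries c (z - z0) (f z)).

(* Main.v *)
Require Import Defs.
From Stdlib Require Import Reals Lra Lia.
From Stdlib Require Import Classical ClassicalEpsilon FunctionalExtensionality.
From Coquelicot Require Import Coquelicot.

Local Open Scope C_scope.

(** Let [a] be the coefficients of the local series of [f] at 0.  Dividing
    the Taylor remainder by a power of [z] gives, for every [n],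
    [f z = sum_(k < n) a k * z ^ k + z ^ n * g z] on the disc
    ([disc_germ_factor]), where [g] is again locally a power series around
    every point of the disc, the origin included.  The maximum principle for
    [g] on the circle of radius [r] turns a bound [B] of the remainder on that
    circle into the bound [B * (Cmod z / r) ^ n] at every [z] inside it
    ([disc_germ_max]).  So the series converges to [f] at every [z] with
    [Cmod z < r], as soon as [B] can be chosen independently of [n]; since [f]
    is bounded on smaller closed discs, this only asks for a bound of the
    partial sums, that is, for the Cauchy estimates
    [Cmod (a n) * s ^ n <= max_(Cmod z = s) Cmod (f z)] with [r < s < 1].
    The identity theorem is never needed: equality with [f] and convergence
    come together.

    The Cauchy estimates are proved without integrals ([cauchy_estimate]).
    When [a k = 0] for all [k < n] the remainder is [f] itself, and the
    estimate is the maximum principle for [f z / z ^ n] at the origin.  The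
    lower coefficients are removed one at a time: for [w ^ d = -1] with
    [Cmod w = 1], replacing [f z] by [(f z + w ^ -n * f (w * z)) / 2] keeps the
    coefficient of index [n], annihilates the one of index [n - d], keeps the
    coefficients that vanish already, and does not increase the bound on
    circles around 0.

    The maximum principle ([maximum_principle]) uses only a second-order
    expansion with a cubic remainder at each point.  Averaged over the four
    points [p + t], [p - t], [p + i t], [p - i t], such a function returns its
    value at [p] up to a multiple of [t ^ 3], while the average of the squared
    modulus exceeds its value at [p] by exactly [t ^ 2].  Hence
    [Cmod (g z) + eps * Cmod z ^ 2] has no interior maximum, and [eps] tends
    to 0. *)

(** * Germs at the origin *)

Definition near0 (P : C -> Prop) : Prop :=
  exists d : R, (0 < d)%R /\ forall h : C, (Cmod h < d)%R -> P h.

Definition bounded_near0 (e : C -> C) : Prop :=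
  exists K : R, near0 (fun h => (Cmod (e h) <= K)%R).

Lemma near0_and P Q : near0 P -> near0 Q -> near0 (fun h => P h /\ Q h).
Proof.
intros [d [Hd HP]] [d' [Hd' HQ]].
exists (Rmin d d'); split; [now apply Rmin_pos|].
intros h Hh; pose proof (Rmin_l d d'); pose proof (Rmin_r d d').
split; [apply HP | apply HQ]; lra.
Qed.

Lemma near0_imp (P Q : C -> Prop) :
  (forall h, P h -> Q h) -> near0 P -> near0 Q.
Proof. intros H [d [Hd HP]]; exists d; split; auto. Qed.

Lemma near0_all (P : C -> Prop) : (forall h, P h) -> near0 P.
Proof. intros H; exists 1%R; split; [lra | auto]. Qed.

Lemma near0_lt r : (0 < r)%R -> near0 (fun h => (Cmod h < r)%R).
Proof. intros H; exists r; auto. Qed.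

Lemma near0_rotate (w : C) P :
  Cmod w = 1%R -> near0 P -> near0 (fun h => P (w * h)).
Proof.
intros Hw [d [Hd HP]]; exists d; split; [exact Hd|].
intros h Hh; apply HP; rewrite Cmod_mult, Hw; lra.
Qed.

Lemma bounded_const c : bounded_near0 (fun _ => c).
Proof. exists (Cmod c); apply near0_all; intros; lra. Qed.

Lemma bounded_id : bounded_near0 (fun h => h).
Proof.
exists 1%R; apply (near0_imp (fun h => (Cmod h < 1)%R)); [intros; lra|].
apply near0_lt; lra.
Qed.

Lemma bounded_plus e1 e2 :
  bounded_near0 e1 -> bounded_near0 e2 -> bounded_near0 (fun h => e1 h + e2 h).
Proof.
intros [K1 H1] [K2 H2]; exists (K1 + K2)%R.
generalize (near0_and _ _ H1 H2); apply near0_imp; intros h [? ?].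
pose proof (Cmod_triangle (e1 h) (e2 h)); lra.
Qed.

Lemma bounded_mult e1 e2 :
  bounded_near0 e1 -> bounded_near0 e2 -> bounded_near0 (fun h => e1 h * e2 h).
Proof.
intros [K1 H1] [K2 H2]; exists (K1 * K2)%R.
generalize (near0_and _ _ H1 H2); apply near0_imp; intros h [? ?].
rewrite Cmod_mult; apply Rmult_le_compat; auto using Cmod_ge_0.
Qed.

Lemma bounded_rotate (w : C) e :
  Cmod w = 1%R -> bounded_near0 e -> bounded_near0 (fun h => e (w * h)).
Proof.
intros Hw [K H]; exists K; exact (near0_rotate w _ Hw H).
Qed.

(** * Second-order expansions *)

(** Local power series have this property, and it passes easily to products
    and quotients, so that no product of series has to be formed. *)
Definition expands2 (g : C -> C) (z : C) : Prop :=
  exists (c0 c1 c2 : C) (e : C -> C),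
    bounded_near0 e /\
    near0 (fun h => g (z + h) = c0 + c1 * h + c2 * (h * h) + h * h * h * e h).

Ltac bounded :=
  repeat first [ apply bounded_plus | apply bounded_mult | apply bounded_const
               | apply bounded_id | assumption ].

Lemma expands2_ext f g z :
  near0 (fun h => f (z + h) = g (z + h)) -> expands2 f z -> expands2 g z.
Proof.
intros Hfg (c0 & c1 & c2 & e & He & H); exists c0, c1, c2, e; split; [exact He|].
generalize (near0_and _ _ Hfg H); apply near0_imp; intros h [E ?]; congruence.
Qed.

Lemma expands2_const c z : expands2 (fun _ => c) z.
Proof.
exists c, 0, 0, (fun _ => 0); split; [bounded|].
apply near0_all; intros; ring.
Qed.

Lemma expands2_plus f g z :
  expands2 f z -> expands2 g z -> expands2 (fun x => f x + g x) z.
Proof.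
intros (c0 & c1 & c2 & e & He & H) (d0 & d1 & d2 & e' & He' & H').
exists (c0 + d0), (c1 + d1), (c2 + d2), (fun h => e h + e' h); split; [bounded|].
generalize (near0_and _ _ H H'); apply near0_imp; intros h [-> ->]; ring.
Qed.

Lemma expands2_mult f g z :
  expands2 f z -> expands2 g z -> expands2 (fun x => f x * g x) z.
Proof.
intros (c0 & c1 & c2 & e & He & H) (d0 & d1 & d2 & e' & He' & H').
exists (c0 * d0), (c0 * d1 + c1 * d0), (c0 * d2 + c1 * d1 + c2 * d0),
  (fun h => (c1 * d2 + c2 * d1) + c2 * d2 * h
            + (c0 + c1 * h + c2 * (h * h)) * e' h
            + (d0 + d1 * h + d2 * (h * h)) * e h
            + h * h * h * e h * e' h); split; [bounded|].
generalize (near0_and _ _ H H'); apply near0_imp; intros h [-> ->]; ring.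
Qed.

Lemma expands2_rotate (w : C) f z :
  Cmod w = 1%R -> expands2 f (w * z) -> expands2 (fun x => f (w * x)) z.
Proof.
intros Hw (c0 & c1 & c2 & e & He & H).
exists c0, (c1 * w), (c2 * (w * w)), (fun h => w * w * w * e (w * h)); split.
- pose proof (bounded_rotate w e Hw He); bounded.
- generalize (near0_rotate w _ Hw H); apply near0_imp; intros h E.
  replace (w * (z + h)) with (w * z + w * h) by ring; rewrite E; ring.
Qed.

Lemma expands2_inv (z : C) : z <> 0 -> expands2 Cinv z.
Proof.
intros Hz.
assert (Hm : (0 < Cmod z)%R) by exact (proj1 (Cmod_gt_0 z) Hz).
assert (Hn : near0 (fun h => (Cmod z / 2 <= Cmod (z + h))%R)).
{ apply (near0_imp (fun h => (Cmod h < Cmod z / 2)%R)); [|apply near0_lt; lra].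
  intros h Hh.
  pose proof (Cmod_triangle (z + h) (- h)) as T.
  replace (z + h + - h) with z in T by ring; rewrite Cmod_opp in T; lra. }
assert (N : forall h, (Cmod z / 2 <= Cmod (z + h))%R -> z + h <> 0).
{ intros h Hh; apply (proj2 (Cmod_gt_0 _)); lra. }
exists (/ z), (- / (z * z)), (/ (z * z * z)),
  (fun h => (- / (z * z * z)) * / (z + h)); split.
- apply bounded_mult; [bounded|].
  exists (/ (Cmod z / 2))%R; revert Hn; apply near0_imp; intros h Hh.
  rewrite (Cmod_inv _ (N h Hh)); apply Rinv_le_contravar; lra.
- revert Hn; apply near0_imp; intros h Hh; field; split; [exact (N h Hh) | exact Hz].
Qed.

(** * Maximum principle *)

Lemma Cmod_le_abs (z : C) : (Cmod z <= Rabs (fst z) + Rabs (snd z))%R.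
Proof.
destruct z as [x y]; simpl.
replace (x, y) with (RtoC x + RtoC y * Ci).
2: { unfold RtoC, Ci, Cplus, Cmult; simpl; f_equal; ring. }
eapply Rle_trans; [apply Cmod_triangle|].
rewrite Cmod_mult, Cmod_Ci, !Cmod_R; lra.
Qed.

(** Compactness of the closed disc, for a property [P d q] that is local in
    [q] and inherited by smaller [d].  The two-dimensional covering lemma works
    on the square around the disc, so the points of the square outside the disc
    get neighbourhoods that avoid the disc. *)
Lemma disc_uniform (r : R) (P : R -> C -> Prop) :
  (forall d d' q, (d' <= d)%R -> P d q -> P d' q) ->
  (forall p, (Cmod p <= r)%R -> exists d : R, (0 < d)%R /\
     forall q, (Cmod (q - p) < d)%R -> P d q) ->
  exists d : R, (0 < d)%R /\ forall q, (Cmod q <= r)%R -> P d q.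
Proof.
intros Hmono Hloc.
assert (Hd : forall p : C, exists d : posreal, forall q : C,
  (Cmod q <= r)%R -> (Cmod (q - p) < 2 * d)%R -> P d q).
{ intros p; destruct (Rle_dec (Cmod p) r) as [Hp|Hp].
  - destruct (Hloc _ Hp) as (d & Hd & H).
    assert (Hd2 : (0 < d / 2)%R) by lra.
    exists (mkposreal _ Hd2); simpl; intros q _ Hq.
    apply (Hmono d); [lra | apply H; lra].
  - assert (Hd2 : (0 < (Cmod p - r) / 2)%R) by lra.
    exists (mkposreal _ Hd2); simpl; intros q Hqr Hq; exfalso.
    pose proof (Cmod_triangle q (- (q - p))) as T.
    replace (q + - (q - p)) with p in T by ring.
    rewrite Cmod_opp in T; lra. }
set (delta := fun u v =>
  proj1_sig (constructive_indefinite_description _ (Hd (u, v)))).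
destruct (compactness_value_2d (- r) r (- r) r delta) as [d H].
exists d; split; [apply cond_pos|].
intros q Hq; apply NNPP; intro Hn.
pose proof (Rmax_Cmod q) as Hmax.
pose proof (Rmax_l (Rabs (fst q)) (Rabs (snd q))).
pose proof (Rmax_r (Rabs (fst q)) (Rabs (snd q))).
apply (H (fst q) (snd q)).
1,2: apply Rabs_le_between; lra.
intros (u & v & _ & _ & Hx & Hy & Hle); apply Hn.
apply (Hmono (delta u v)); [exact Hle|].
unfold delta in *.
destruct (constructive_indefinite_description _ (Hd (u, v))) as [d' Hd']; simpl in *.
apply Hd'; [exact Hq|].
eapply Rle_lt_trans; [apply Cmod_le_abs|].
destruct q as [x y]; simpl in *.
unfold Rminus in Hx, Hy; lra.
Qed.

(** Two uses of compactness: one bounds [phi], the other shows that a supremum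
    [S] which is not attained could be lowered to [S - d]. *)
Lemma disc_max (r : R) (phi : C -> R) :
  (0 <= r)%R ->
  (forall p, (Cmod p <= r)%R -> exists L : R, (0 <= L)%R /\
     near0 (fun h => (phi (p + h)%C <= phi p + L * Cmod h)%R)) ->
  exists p, (Cmod p <= r)%R /\ forall q, (Cmod q <= r)%R -> (phi q <= phi p)%R.
Proof.
intros Hr Hphi.
assert (Hloc : forall p, (Cmod p <= r)%R -> exists L d : R, (0 <= L)%R /\
  (0 < d)%R /\ forall q, (Cmod (q - p) < d)%R ->
  (phi q <= phi p + L * Cmod (q - p))%R).
{ intros p Hp; destruct (Hphi p Hp) as (L & HL & d & Hd & H).
  exists L, d; repeat split; auto; intros q Hq.
  specialize (H _ Hq); replace (p + (q - p)) with q in H by ring; exact H. }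
assert (Hb : exists M, forall q, (Cmod q <= r)%R -> (phi q <= M)%R).
{ (* The second disjunct makes the property decreasing in d for all real d,
     although / d is decreasing only for positive d. *)
  destruct (disc_uniform r (fun d q => (phi q <= / d \/ d <= 0)%R)) as (d & Hd & H).
  - intros d d' q Hle [H|H]; destruct (Rle_dec d' 0); auto; [|lra].
    left; eapply Rle_trans; [exact H|].
    apply Rinv_le_contravar; lra.
  - intros p Hp; destruct (Hloc p Hp) as (L & d & HL & Hd & H).
    set (B := (Rabs (phi p) + L * d + 1)%R).
    assert (HB : (0 < B)%R).
    { unfold B; pose proof (Rabs_pos (phi p)); nra. }
    assert (HB' := Rinv_0_lt_compat _ HB).
    exists (Rmin d (/ B)); split; [now apply Rmin_pos|].
    intros q Hq; left.
    pose proof (Rmin_l d (/ B)); pose proof (Rmin_r d (/ B)).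
    assert (Hq' : (Cmod (q - p) < d)%R) by lra.
    specialize (H q Hq').
    pose proof (Rle_abs (phi p)).
    apply Rle_trans with B; [unfold B; nra|].
    rewrite <- (Rinv_inv B) at 1.
    apply Rinv_le_contravar; [now apply Rmin_pos | lra].
  - exists (/ d)%R; intros q Hq; destruct (H q Hq); lra. }
destruct Hb as [M HM].
destruct (completeness (fun x => exists q, (Cmod q <= r)%R /\ x = phi q))
  as [S [Sub Slub]].
- exists M; intros x (q & Hq & ->); auto.
- exists (phi 0), 0; rewrite Cmod_0; auto.
- apply NNPP; intro Hn.
  assert (Hlt : forall p, (Cmod p <= r)%R -> (phi p < S)%R).
  { intros p Hp; apply Rnot_le_lt; intro Hle; apply Hn.
    exists p; split; [exact Hp|]; intros q Hq.
    apply Rle_trans with S; [|exact Hle]; apply Sub; eauto. }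
  destruct (disc_uniform r (fun d q => (phi q <= S - d)%R)) as (d & Hd & H).
  + intros; lra.
  + intros p Hp; destruct (Hloc p Hp) as (L & d & HL & Hd & H).
    specialize (Hlt p Hp).
    set (t := ((S - phi p) / (1 + L))%R).
    assert (Ht : (0 < t)%R) by (apply Rdiv_lt_0_compat; lra).
    assert (Et : (t * (1 + L) = S - phi p)%R) by (unfold t; field; lra).
    exists (Rmin d t); split; [now apply Rmin_pos|].
    intros q Hq.
    pose proof (Rmin_l d t); pose proof (Rmin_r d t).
    assert (Hq' : (Cmod (q - p) < d)%R) by lra.
    specialize (H q Hq'); nra.
  + assert (S <= S - d)%R; [|lra].
    apply Slub; intros x (q & Hq & ->); auto.
Qed.

Lemma expands2_lipschitz g p :
  expands2 g p ->
  exists K, (0 <= K)%R /\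
    near0 (fun h => (Cmod (g (p + h)%C) <= Cmod (g p) + K * Cmod h)%R).
Proof.
intros (c0 & c1 & c2 & e & He & H).
assert (Hp : g p = c0).
{ destruct H as (d & Hd & H).
  specialize (H 0); rewrite Cmod_0 in H; specialize (H Hd).
  rewrite Cplus_0_r in H; rewrite H; ring. }
assert (B : bounded_near0 (fun h => c1 + c2 * h + h * h * e h)) by bounded.
destruct B as [K B]; exists (Rabs K); split; [apply Rabs_pos|].
generalize (near0_and _ _ H B); apply near0_imp; intros h [E Hh].
rewrite E, Hp.
replace (c0 + c1 * h + c2 * (h * h) + h * h * h * e h)
  with (c0 + (c1 + c2 * h + h * h * e h) * h) by ring.
eapply Rle_trans; [apply Cmod_triangle|].
rewrite Cmod_mult; pose proof (Cmod_ge_0 h); pose proof (Rle_abs K); nra.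
Qed.

(** At a local maximum, comparing with the average over the four points at
    distance [t] would give [eps * t ^ 2 <= K * t ^ 3] for all small [t], where
    [K] bounds the cubic remainder. *)
Lemma expands2_no_max g p eps :
  (0 < eps)%R -> expands2 g p ->
  ~ near0 (fun h =>
      (Cmod (g (p + h)%C) + eps * (Cmod (p + h) * Cmod (p + h))
       <= Cmod (g p) + eps * (Cmod p * Cmod p))%R).
Proof.
intros Heps (c0 & c1 & c2 & e & [K He] & H) Hmax.
destruct (near0_and _ _ H (near0_and _ _ He Hmax)) as (d & Hd & N).
assert (Hp : g p = c0).
{ destruct (N 0) as [N0 _]; [rewrite Cmod_0; lra|].
  rewrite Cplus_0_r in N0; rewrite N0; ring. }
assert (HK : (0 <= K)%R).
{ destruct (N 0) as [_ [N0 _]]; [rewrite Cmod_0; lra|].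
  pose proof (Cmod_ge_0 (e 0)); lra. }
set (t := Rmin (d / 2) (eps / (2 * (K + 1)))).
assert (T1 : (t <= d / 2)%R) by apply Rmin_l.
assert (T2 : (t <= eps / (2 * (K + 1)))%R) by apply Rmin_r.
assert (Ht : (0 < t)%R).
{ apply Rmin_pos; [lra | apply Rdiv_lt_0_compat; lra]. }
assert (HtK : (K * t < eps)%R).
{ assert (E : (eps / (2 * (K + 1)) * (2 * (K + 1)) = eps)%R) by (field; lra).
  nra. }
assert (Hmt : Cmod t = t) by (rewrite Cmod_R; apply Rabs_pos_eq; lra).
assert (Hm : forall h, Cmod h = t -> (Cmod h < d)%R) by (intros; lra).
destruct (N (RtoC t)) as (A1 & B1 & M1); [now apply Hm|].
destruct (N (- RtoC t)) as (A2 & B2 & M2); [now apply Hm; rewrite Cmod_opp|].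
destruct (N (Ci * t)) as (A3 & B3 & M3);
  [now apply Hm; rewrite Cmod_mult, Cmod_Ci, Hmt; ring|].
destruct (N (- (Ci * t))) as (A4 & B4 & M4);
  [now apply Hm; rewrite Cmod_opp, Cmod_mult, Cmod_Ci, Hmt; ring|].
set (rem := e (RtoC t) + - e (- RtoC t) + - Ci * e (Ci * t) + Ci * e (- (Ci * t))).
assert (Hrem : (Cmod rem <= 4 * K)%R).
{ unfold rem; repeat (eapply Rle_trans; [apply Cmod_triangle|]).
  eapply Rle_trans; [apply Rplus_le_compat_r, Cmod_triangle|].
  eapply Rle_trans; [apply Rplus_le_compat_r, Rplus_le_compat_r, Cmod_triangle|].
  rewrite !Cmod_mult, !Cmod_opp, Cmod_Ci; lra. }
assert (Ci2 : Ci * Ci = - (1)).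
{ unfold Ci, Cmult, Copp, RtoC; simpl; f_equal; ring. }
(* The four increments, and their four squares, have sum zero.  The sum of the
   right-hand sides is 4 c0 only modulo i ^ 2 + 1, which ring does not know;
   hence the explicit multiple of Ci * Ci + 1. *)
assert (Hsum : RtoC 4 * c0 =
  g (p + t) + g (p + - RtoC t) + g (p + Ci * t) + g (p + - (Ci * t))
  + - (RtoC t * t * t * rem)).
{ rewrite A1, A2, A3, A4; unfold rem.
  transitivity (RtoC 4 * c0 + (Ci * Ci + 1) *
     (RtoC 2 * c2 * t * t + Ci * (e (Ci * t) - e (- (Ci * t))) * t * t * t)).
  - rewrite Ci2; ring.
  - ring. }
assert (Hq : (Cmod (p + t) * Cmod (p + t) + Cmod (p + - RtoC t) * Cmod (p + - RtoC t)
  + Cmod (p + Ci * t) * Cmod (p + Ci * t) + Cmod (p + - (Ci * t)) * Cmod (p + - (Ci * t))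
  = 4 * (Cmod p * Cmod p) + 4 * (t * t))%R).
{ assert (S : forall z, (Cmod z * Cmod z = Re z ^ 2 + Im z ^ 2)%R).
  { intros z; rewrite <- Cmod2_alt; ring. }
  rewrite !S; destruct p; unfold Re, Im; simpl; ring. }
assert (Hc : (4 * Cmod c0 <= Cmod (g (p + t)%C) + Cmod (g (p + - RtoC t)%C)
  + Cmod (g (p + Ci * t)%C) + Cmod (g (p + - (Ci * t))%C) + t * t * t * (4 * K))%R).
{ replace (4 * Cmod c0)%R with (Cmod (RtoC 4 * c0)).
  2: { rewrite Cmod_mult, Cmod_R, Rabs_pos_eq; lra. }
  rewrite Hsum.
  eapply Rle_trans; [apply Cmod_triangle|].
  rewrite Cmod_opp, !Cmod_mult, Hmt.
  apply Rplus_le_compat.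
  - eapply Rle_trans; [apply Cmod_triangle|]; apply Rplus_le_compat_r.
    eapply Rle_trans; [apply Cmod_triangle|]; apply Rplus_le_compat_r.
    apply Cmod_triangle.
  - apply Rmult_le_compat_l; [|exact Hrem]; apply Rlt_le.
    repeat apply Rmult_lt_0_compat; exact Ht. }
rewrite Hp in *.
assert (F : (eps * (t * t) <= K * t * (t * t))%R) by nra.
assert (0 < t * t)%R by nra.
nra.
Qed.

Lemma maximum_principle g r M :
  (0 <= r)%R ->
  (forall z, (Cmod z <= r)%R -> expands2 g z) ->
  (forall z, Cmod z = r -> (Cmod (g z) <= M)%R) ->
  forall z, (Cmod z <= r)%R -> (Cmod (g z) <= M)%R.
Proof.
intros Hr Hg HM z Hz.
apply le_epsilon; intros eps0 Heps0.
set (eps := (eps0 / (r * r + 1))%R).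
assert (Heps : (0 < eps)%R) by (apply Rdiv_lt_0_compat; nra).
assert (Ee : (eps * (r * r) <= eps0)%R).
{ assert (eps * (r * r + 1) = eps0)%R by (unfold eps; field; nra); nra. }
destruct (disc_max r (fun z => (Cmod (g z) + eps * (Cmod z * Cmod z))%R) Hr)
  as (p & Hp & Hmax).
{ intros p Hp; destruct (expands2_lipschitz g p (Hg p Hp)) as (K & HK & H).
  pose proof (Cmod_ge_0 p).
  exists (K + eps * (2 * Cmod p + 1))%R; split; [nra|].
  generalize (near0_and _ _ H (near0_lt 1 Rlt_0_1)).
  apply near0_imp; intros h [Hh H1].
  pose proof (Cmod_triangle p h); pose proof (Cmod_ge_0 h).
  pose proof (Cmod_ge_0 (p + h)).
  assert (Cmod (p + h) * Cmod (p + h) <=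
    Cmod p * Cmod p + (2 * Cmod p + 1) * Cmod h)%R by nra.
  nra. }
pose proof (Cmod_ge_0 p); pose proof (Cmod_ge_0 z).
destruct (Rle_lt_or_eq_dec _ _ Hp) as [Hlt|Heq].
- exfalso; apply (expands2_no_max g p eps Heps (Hg p Hp)).
  apply (near0_imp (fun h => (Cmod h < r - Cmod p)%R)); [|apply near0_lt; lra].
  intros h Hh; apply Hmax; pose proof (Cmod_triangle p h); lra.
- specialize (Hmax z Hz); specialize (HM p Heq); simpl in Hmax.
  rewrite Heq in Hmax; nra.
Qed.

(** * Sums of power series *)

(** The sum of the first [n] terms, so that [psum c z 0] is the empty sum;
    [sum_n] would include the term of index [n]. *)
Fixpoint psum (c : nat -> C) (z : C) (n : nat) : C :=
  match n with
  | O => 0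
  | S m => psum c z m + c m * z ^ m
  end.

Lemma psum_sum_n (c : nat -> C) (z : C) (n : nat) :
  psum c z (S n) = sum_n (fun k => scal (pow_n z k) (c k)) n.
Proof.
assert (E : forall k, scal (pow_n z k) (c k) = c k * z ^ k).
{ intros k; apply Cmult_comm. }
induction n as [|n IH].
- rewrite sum_O, E; simpl; ring.
- rewrite sum_Sn, <- IH, E; reflexivity.
Qed.

Lemma is_pseries_psum (c : nat -> C) (z l : C) :
  is_pseries c z l <->
  forall eps : R, (0 < eps)%R -> exists N : nat, forall n : nat, (N <= n)%nat ->
    (Cmod (psum c z (S n) - l) < eps)%R.
Proof.
unfold is_pseries, is_series.
rewrite (filterlim_locally_ball_norm (K := C_AbsRing) (U := C_NormedModule)).
split.
- intros H eps Heps; destruct (H (mkposreal eps Heps)) as [N HN].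
  exists N; intros n Hn; rewrite psum_sum_n; exact (HN n Hn).
- intros H eps; destruct (H eps (cond_pos eps)) as [N HN].
  exists N; intros n Hn; specialize (HN n Hn); rewrite psum_sum_n in HN; exact HN.
Qed.

Lemma psum_Sl c z n : psum c z (S n) = c O + z * psum (fun k => c (S k)) z n.
Proof.
induction n as [|n IH]; [simpl; ring|].
change (psum c z (S (S n))) with (psum c z (S n) + c (S n) * z ^ S n).
rewrite IH; simpl; ring.
Qed.

Lemma is_pseries_at_0 (c : nat -> C) (l : C) : is_pseries c (RtoC 0) l -> l = c O.
Proof.
intros H; apply (filterlim_locally_unique (K := C_AbsRing) (V := C_NormedModule) _ _ _ H).
exact (is_pseries_0 (K := C_AbsRing) (V := C_NormedModule) c).
Qed.

(** The terms are bounded by [B] at one radius [rho], so at half of it the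
    series is dominated by a geometric series of ratio [1/2]. *)
Lemma series_germ_bounded (c : nat -> C) (f : C -> C) :
  near0 (fun h => is_pseries c h (f h)) -> bounded_near0 f.
Proof.
intros (d & Hd & H).
assert (Hmr : Cmod (d / 2)%R = (d / 2)%R) by (rewrite Cmod_R, Rabs_pos_eq; lra).
set (rho := (d / 2)%R) in *.
assert (Hrho : (0 < rho)%R) by (unfold rho; lra).
assert (Hconv : is_pseries c (RtoC rho) (f rho)) by (apply H; rewrite Hmr; unfold rho; lra).
(* Each term is a difference of two consecutive partial sums, both close to
   the limit from some index on. *)
assert (HB : exists B, (0 <= B)%R /\ forall n, (Cmod (c n) * rho ^ n <= B)%R).
{ rewrite is_pseries_psum in Hconv.
  destruct (Hconv 1%R Rlt_0_1) as [N HN].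
  assert (Hfin : forall m, exists B, (0 <= B)%R /\
    forall n, (n < m)%nat -> (Cmod (c n) * rho ^ n <= B)%R).
  { induction m as [|m (B & HB0 & HB)].
    - exists 0%R; split; [lra | intros; lia].
    - exists (Rmax B (Cmod (c m) * rho ^ m)); split.
      + pose proof (Rmax_l B (Cmod (c m) * rho ^ m)); lra.
      + intros n Hn; destruct (Nat.eq_dec n m) as [->|Hne]; [apply Rmax_r|].
        eapply Rle_trans; [apply HB; lia | apply Rmax_l]. }
  destruct (Hfin (S N)) as (B & HB0 & HB).
  exists (Rmax B 2); split; [pose proof (Rmax_l B 2); lra|].
  intros n; destruct (Compare_dec.le_lt_dec n N) as [Hn|Hn].
  - eapply Rle_trans; [apply HB; lia | apply Rmax_l].
  - apply Rle_trans with 2%R; [|apply Rmax_r].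
    destruct n as [|n]; [lia|].
    pose proof (HN (S n) ltac:(lia)) as H1; pose proof (HN n ltac:(lia)) as H0.
    replace (Cmod (c (S n)) * rho ^ S n)%R with (Cmod (c (S n) * RtoC rho ^ S n)).
    2: { rewrite Cmod_mult, Cmod_pow, Hmr; reflexivity. }
    replace (c (S n) * RtoC rho ^ S n) with
      ((psum c rho (S (S n)) - f rho) + - (psum c rho (S n) - f rho))
      by (simpl; ring).
    eapply Rle_trans; [apply Cmod_triangle|]; rewrite Cmod_opp; lra. }
destruct HB as (B & HB0 & HB).
exists (2 * B + 1)%R; exists (rho / 2)%R; split; [lra|]; intros h Hh.
assert (Hsum : forall n, (Cmod (psum c h n) <= 2 * B * (1 - (/ 2) ^ n))%R).
{ induction n as [|n IH]; [simpl; rewrite Cmod_0; lra|].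
  change (psum c h (S n)) with (psum c h n + c n * h ^ n).
  eapply Rle_trans; [apply Cmod_triangle|].
  rewrite Cmod_mult, Cmod_pow.
  assert (Cmod (c n) * Cmod h ^ n <= B * (/ 2) ^ n)%R.
  { apply Rle_trans with (Cmod (c n) * (rho * / 2) ^ n)%R.
    - apply Rmult_le_compat_l; [apply Cmod_ge_0|].
      apply pow_incr; split; [apply Cmod_ge_0 | lra].
    - rewrite Rpow_mult_distr, <- Rmult_assoc.
      apply Rmult_le_compat_r; [apply pow_le; lra | apply HB]. }
  simpl; lra. }
assert (Hh' : is_pseries c h (f h)) by (apply H; unfold rho in *; lra).
rewrite is_pseries_psum in Hh'.
destruct (Hh' 1%R Rlt_0_1) as [N HN]; specialize (HN N (le_n N)).
specialize (Hsum (S N)).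
pose proof (Cmod_triangle (psum c h (S N)) (- (psum c h (S N) - f h))) as T.
replace (psum c h (S N) + - (psum c h (S N) - f h)) with (f h) in T by ring.
rewrite Cmod_opp in T.
assert (0 <= (/ 2) ^ S N)%R by (apply pow_le; lra).
nra.
Qed.

(** The sum of the series with the first coefficient dropped.  Defining it from
    the values of [f] makes sense wherever [f] does, also where the series at
    the origin is not known to converge. *)
Definition shift (c : nat -> C) (f : C -> C) (z : C) : C :=
  if excluded_middle_informative (z = 0) then c 1%nat else (f z - c O) / z.

Lemma shift_eq (c : nat -> C) (f : C -> C) (z : C) : f 0 = c O -> f z = c O + z * shift c f z.
Proof.
intros H0; unfold shift; destruct (excluded_middle_informative (z = 0)) as [->|Hz].
- rewrite H0; ring.
- field; exact Hz.
Qed.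

Lemma shift_series (c : nat -> C) (f : C -> C) :
  near0 (fun h => is_pseries c h (f h)) ->
  near0 (fun h => is_pseries (fun k => c (S k)) h (shift c f h)).
Proof.
apply near0_imp; intros h Hh.
unfold shift; destruct (excluded_middle_informative (h = 0)) as [->|Hz].
- exact (is_pseries_0 (K := C_AbsRing) (V := C_NormedModule) (fun k => c (S k))).
- replace ((f h - c O) / h) with (scal (/ h) (plus (f h) (opp (c O)))).
  + apply (is_pseries_decr_1 (K := C_AbsRing) (V := C_NormedModule)); [|exact Hh].
    exact (Cinv_l h Hz).
  + change (/ h * (f h + - c O) = (f h - c O) / h); field; exact Hz.
Qed.

Lemma near0_at_0 P : near0 P -> P 0.
Proof. intros (d & Hd & H); apply H; rewrite Cmod_0; exact Hd. Qed.

(** Three shifts write [f] as [c 0 + h (c 1 + h (c 2 + h e))], where [e] is the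
    sum of a power series and hence bounded near 0. *)
Lemma series_expands2 (c : nat -> C) (f : C -> C) (z : C) :
  near0 (fun h => is_pseries c h (f (z + h))) -> expands2 f z.
Proof.
intros H.
set (c1 := fun k => c (S k)); set (c2 := fun k => c1 (S k)).
set (g := fun h => f (z + h)).
pose proof (shift_series c g H) as H1.
pose proof (shift_series c1 _ H1) as H2.
pose proof (shift_series c2 _ H2) as H3.
exists (c O), (c1 O), (c2 O), (shift c2 (shift c1 (shift c g))).
split; [exact (series_germ_bounded _ _ H3)|].
apply near0_all; intros h.
change (f (z + h)) with (g h).
rewrite (shift_eq c g) at 1 by exact (is_pseries_at_0 _ _ (near0_at_0 _ H)).
rewrite (shift_eq c1 (shift c g)) at 1 by exact (is_pseries_at_0 _ _ (near0_at_0 _ H1)).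
rewrite (shift_eq c2 (shift c1 (shift c g))) at 1 by exact (is_pseries_at_0 _ _ (near0_at_0 _ H2)).
ring.
Qed.

(** * Cauchy estimates *)

(** [c] is the germ of [f] at the origin; nothing is assumed about the radius
    of convergence of [c] beyond its being positive. *)
Definition disc_germ (f : C -> C) (c : nat -> C) : Prop :=
  (forall z, (Cmod z < 1)%R -> expands2 f z) /\
  near0 (fun h => is_pseries c h (f h)).

Lemma disc_germ_at_0 f c : disc_germ f c -> f 0 = c O.
Proof. intros [_ H]; exact (is_pseries_at_0 _ _ (near0_at_0 _ H)). Qed.

(** At the origin the shifted function is a power series again; elsewhere it is
    [f - c 0] multiplied by the inverse function. *)
Lemma disc_germ_shift f c :
  disc_germ f c -> disc_germ (shift c f) (fun k => c (S k)).
Proof.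
intros [Hf Hc]; pose proof (shift_series c f Hc) as Hs.
split; [|exact Hs]; intros z Hz.
destruct (excluded_middle_informative (z = 0)) as [->|Hz0].
- apply (series_expands2 (fun k => c (S k))).
  revert Hs; apply near0_imp; intros h; rewrite Cplus_0_l; auto.
- apply (expands2_ext (fun x => (f x + - c O) * / x)).
  + assert (Hm : (0 < Cmod z)%R) by exact (proj1 (Cmod_gt_0 z) Hz0).
    generalize (near0_lt _ Hm); apply near0_imp; intros h Hh.
    unfold shift; destruct (excluded_middle_informative (z + h = 0)) as [E|E]; [|reflexivity].
    exfalso.
    replace z with (- h) in Hh by (replace h with (z + h - z) by ring; rewrite E; ring).
    rewrite Cmod_opp in Hh; lra.
  + apply expands2_mult; [|now apply expands2_inv].
    apply expands2_plus; [now apply Hf | apply expands2_const].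
Qed.

Lemma disc_germ_factor n f c :
  disc_germ f c -> exists g, disc_germ g (fun k => c (n + k)%nat) /\
    forall z, f z = psum c z n + z ^ n * g z.
Proof.
induction n as [|n IH]; intros Hf.
- exists f; split; [exact Hf|]; intros z; simpl; ring.
- destruct (IH Hf) as (g & Hg & E).
  exists (shift (fun k => c (n + k)%nat) g); split.
  + replace (fun k => c (S n + k)%nat) with (fun k => c (n + S k)%nat).
    * exact (disc_germ_shift _ _ Hg).
    * apply functional_extensionality; intros k.
      f_equal; lia.
  + intros z; rewrite E, (shift_eq _ _ z (disc_germ_at_0 _ _ Hg)), Nat.add_0_r.
    simpl; ring.
Qed.

(** The maximum principle for the quotient of the remainder by [z ^ n], on the
    disc and at its centre, where this quotient has the value [c n]. *)
Lemma disc_germ_max n f c r M :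
  disc_germ f c -> (0 < r < 1)%R ->
  (forall z, Cmod z = r -> (Cmod (f z - psum c z n) <= M)%R) ->
  (forall z, (Cmod z <= r)%R ->
     (Cmod (f z - psum c z n) * r ^ n <= M * Cmod z ^ n)%R) /\
  (Cmod (c n) * r ^ n <= M)%R.
Proof.
intros Hf Hr HM.
destruct (disc_germ_factor n f c Hf) as (g & Hg & E).
assert (E' : forall z, f z - psum c z n = z ^ n * g z).
{ intros z; rewrite E; ring. }
assert (Hrn : (0 < r ^ n)%R) by (apply pow_lt; lra).
assert (Hmax : forall z, (Cmod z <= r)%R -> (Cmod (g z) * r ^ n <= M)%R).
{ intros z Hz.
  assert (Cmod (g z) <= M / r ^ n)%R.
  { apply (maximum_principle g r); [lra| | |exact Hz].
    - intros w Hw; apply (proj1 Hg); lra.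
    - intros w Hw; specialize (HM w Hw).
      rewrite E', Cmod_mult, Cmod_pow, Hw in HM.
      apply Rmult_le_reg_l with (r ^ n)%R; [exact Hrn|].
      replace (r ^ n * (M / r ^ n))%R with M by (field; lra); exact HM. }
  apply Rle_trans with (M / r ^ n * r ^ n)%R.
  - apply Rmult_le_compat_r; lra.
  - apply Req_le; field; lra. }
split.
- intros z Hz; rewrite E', Cmod_mult, Cmod_pow.
  rewrite Rmult_assoc, (Rmult_comm M).
  apply Rmult_le_compat_l; [apply pow_le, Cmod_ge_0 | now apply Hmax].
- pose proof (disc_germ_at_0 _ _ Hg) as H0; simpl in H0.
  rewrite Nat.add_0_r in H0; rewrite <- H0.
  apply Hmax; rewrite Cmod_0; lra.
Qed.

Lemma exists_root_of_minus_one (d : nat) :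
  (0 < d)%nat -> exists w : C, Cmod w = 1%R /\ w ^ d = - (1).
Proof.
intros Hd.
assert (dM : forall t k, ((cos t, sin t) : C) ^ k = (cos (INR k * t), sin (INR k * t))).
{ intros t k; induction k as [|k IH].
  - simpl; rewrite Rmult_0_l, cos_0, sin_0; reflexivity.
  - rewrite Cpow_S, IH, S_INR, Rmult_plus_distr_r, Rmult_1_l, cos_plus, sin_plus.
    unfold Cmult; simpl; f_equal; ring. }
exists (cos (PI / INR d), sin (PI / INR d)); split.
- unfold Cmod; simpl.
  replace (_ + _)%R with (Rsqr (sin (PI / INR d)) + Rsqr (cos (PI / INR d)))%R
    by (unfold Rsqr; ring).
  rewrite sin2_cos2; apply sqrt_1.
- rewrite dM.
  replace (INR d * (PI / INR d))%R with PI by (field; apply not_0_INR; lia).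
  rewrite cos_PI, sin_PI; unfold Copp, RtoC; simpl; f_equal; ring.
Qed.

Lemma disc_germ_average (u w : C) f c :
  Cmod w = 1%R -> disc_germ f c ->
  disc_germ (fun z => / RtoC 2 * (f z + u * f (w * z)))
            (fun k => / RtoC 2 * (c k + u * (w ^ k * c k))).
Proof.
intros Hw [Hf Hc]; split.
- intros z Hz.
  apply (expands2_mult (fun _ => / RtoC 2)); [apply expands2_const|].
  apply expands2_plus; [now apply Hf|].
  apply (expands2_mult (fun _ => u)); [apply expands2_const|].
  apply expands2_rotate; [exact Hw|]; apply Hf; rewrite Cmod_mult, Hw; lra.
- generalize (near0_and _ _ Hc (near0_rotate w _ Hw Hc)).
  apply near0_imp; intros h [H1 H2].
  assert (H3 : is_pseries (fun k => w ^ k * c k) h (f (w * h))).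
  { revert H2; unfold is_pseries; apply is_series_ext; intros k.
    change (Cpow (w * h) k * c k = Cpow h k * (w ^ k * c k)).
    rewrite Cpow_mult_l; ring. }
  apply (is_pseries_scal (K := C_AbsRing) (V := C_NormedModule)); [apply Cmult_comm|].
  apply (is_pseries_plus (K := C_AbsRing) (V := C_NormedModule)); [exact H1|].
  apply (is_pseries_scal (K := C_AbsRing) (V := C_NormedModule)); [apply Cmult_comm|].
  exact H3.
Qed.

(** Averaging with [w ^ d = -1] and the weight [u = w ^ -n] multiplies the
    coefficient of index [k] by [(1 + w ^ (k - n)) / 2]: this is 1 for [k = n]
    and 0 for [k = n - d].  As [u] and [w] have modulus one, bounds on circles
    around 0 survive.  The induction takes [d = 1, ..., n]. *)
Lemma kill_lower_coefficients n f c r M :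
  disc_germ f c -> (forall z, Cmod z = r -> (Cmod (f z) <= M)%R) ->
  exists g b, disc_germ g b /\ (forall z, Cmod z = r -> (Cmod (g z) <= M)%R) /\
    b n = c n /\ forall k, (k < n)%nat -> b k = 0.
Proof.
intros Hf HM.
assert (H : forall m, (m <= n)%nat -> exists g b, disc_germ g b /\
  (forall z, Cmod z = r -> (Cmod (g z) <= M)%R) /\
  b n = c n /\ forall k, (n - m <= k < n)%nat -> b k = 0).
{ induction m as [|m IH]; intros Hm.
  - exists f, c; split; [exact Hf|]; split; [exact HM|].
    split; [reflexivity | intros; lia].
  - destruct (IH ltac:(lia)) as (g & b & Hg & Hgm & Hn & Hk).
    destruct (exists_root_of_minus_one (S m) ltac:(lia)) as (w & Hw & Hwm).
    assert (Hw0 : w ^ n <> 0).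
    { apply Cpow_nz; intros E; rewrite E, Cmod_0 in Hw; lra. }
    assert (Hu : Cmod (/ w ^ n) = 1%R).
    { rewrite Cmod_inv by exact Hw0; rewrite Cmod_pow, Hw, pow1; apply Rinv_1. }
    pose proof (disc_germ_average (/ w ^ n) w g b Hw Hg) as Ha.
    assert (H2 : Cmod (/ RtoC 2) = (/ 2)%R).
    { rewrite Cmod_inv, Cmod_R, Rabs_pos_eq; [reflexivity | lra |].
      intros E; apply RtoC_inj in E; lra. }
    eexists _, _; split; [exact Ha|]; cbv beta; split; [|split].
    + intros z Hz; rewrite Cmod_mult, H2.
      pose proof (Cmod_triangle (g z) (/ w ^ n * g (w * z))) as T.
      rewrite Cmod_mult, Hu in T.
      pose proof (Hgm z Hz).
      assert (Cmod (g (w * z)%C) <= M)%R.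
      { apply Hgm; rewrite Cmod_mult, Hw; lra. }
      lra.
    + rewrite Hn; field; exact Hw0.
    + intros k Hkn; destruct (Nat.eq_dec k (n - S m)) as [->|Hne].
      * assert (E : w ^ n = - w ^ (n - S m)).
        { replace (w ^ n) with (w ^ (n - S m) * w ^ S m).
          - rewrite Hwm; ring.
          - rewrite <- Cpow_add_r; f_equal; lia. }
        assert (E' : w ^ (n - S m) = - w ^ n) by (rewrite E; ring).
        rewrite E'.
        replace (/ w ^ n * (- w ^ n * b (n - S m)%nat)) with (- b (n - S m)%nat)
          by (field; exact Hw0).
        ring.
      * rewrite Hk by lia; ring. }
destruct (H n (le_n n)) as (g & b & Hg & Hgm & Hn & Hk).
exists g, b; split; [exact Hg|]; split; [exact Hgm|]; split; [exact Hn|].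
intros k Hkn; apply Hk; lia.
Qed.

Lemma cauchy_estimate n f c r M :
  disc_germ f c -> (0 < r < 1)%R ->
  (forall z, Cmod z = r -> (Cmod (f z) <= M)%R) ->
  (Cmod (c n) * r ^ n <= M)%R.
Proof.
intros Hf Hr HM.
destruct (kill_lower_coefficients n f c r M Hf HM) as (g & b & Hg & Hgm & <- & Hb).
assert (H0 : forall m z, (m <= n)%nat -> psum b z m = 0).
{ induction m as [|m IH]; intros z Hm; [reflexivity|].
  simpl; rewrite IH, Hb by lia; ring. }
apply (disc_germ_max n g b r M Hg Hr).
intros z Hz; rewrite H0 by lia.
replace (g z - 0) with (g z) by ring; auto.
Qed.

(** * The expansion on the whole disc *)

(** With [Cmod z < r < s < 1], the Cauchy estimates at radius [s] bound the
    partial sums on the circle of radius [r] by a geometric series of ratio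
    [q = r / s], uniformly in [n]; the remainder at [z] then decays like
    [(Cmod z / r) ^ n]. *)
Lemma disc_germ_series f c z :
  disc_germ f c -> (Cmod z < 1)%R -> is_pseries c z (f z).
Proof.
intros Hf Hz; pose proof (Cmod_ge_0 z) as Hz0.
set (r := ((2 * Cmod z + 1) / 3)%R); set (s := ((Cmod z + 2) / 3)%R).
assert (Hzr : (Cmod z < r)%R) by (unfold r; lra).
assert (Hrs : (r < s)%R) by (unfold r, s; lra).
assert (Hs : (s < 1)%R) by (unfold s; lra).
assert (Hr : (0 < r)%R) by lra.
assert (HM : exists M, forall w, (Cmod w <= s)%R -> (Cmod (f w) <= M)%R).
{ destruct (disc_max s (fun w => Cmod (f w))) as (p & _ & Hp).
  - lra.
  - intros p Hp; apply expands2_lipschitz; apply (proj1 Hf); lra.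
  - exists (Cmod (f p)); exact Hp. }
destruct HM as [M HM].
assert (HM0 : (0 <= M)%R).
{ apply Rle_trans with (Cmod (f 0)); [apply Cmod_ge_0|].
  apply HM; rewrite Cmod_0; lra. }
assert (Hc : forall n, (Cmod (c n) * s ^ n <= M)%R).
{ intros n; apply (cauchy_estimate n f c s M Hf); [lra|].
  intros w Hw; apply HM; lra. }
set (q := (r / s)%R).
assert (Hq : (q * s = r)%R) by (unfold q; field; lra).
assert (Hq0 : (0 < q)%R) by (apply Rdiv_lt_0_compat; lra).
assert (Hq1 : (q < 1)%R) by nra.
assert (Hsum : forall n w, Cmod w = r ->
  (Cmod (psum c w n) * (1 - q) <= M * (1 - q ^ n))%R).
{ intros n w Hw; induction n as [|n IH]; [simpl; rewrite Cmod_0; lra|].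
  change (psum c w (S n)) with (psum c w n + c n * w ^ n).
  pose proof (Cmod_triangle (psum c w n) (c n * w ^ n)) as T.
  assert (Cmod (c n * w ^ n) <= M * q ^ n)%R.
  { rewrite Cmod_mult, Cmod_pow, Hw, <- Hq, Rpow_mult_distr.
    pose proof (Hc n); assert (0 <= q ^ n)%R by (apply pow_le; lra); nra. }
  simpl; nra. }
set (B := (M + M / (1 - q))%R).
assert (HB : forall n w, Cmod w = r -> (Cmod (f w - psum c w n) <= B)%R).
{ intros n w Hw; unfold B.
  eapply Rle_trans; [apply Cmod_triangle|]; rewrite Cmod_opp.
  apply Rplus_le_compat; [apply HM; lra|].
  apply Rmult_le_reg_r with (1 - q)%R; [lra|].
  replace (M / (1 - q) * (1 - q))%R with M by (field; lra).
  eapply Rle_trans; [apply Hsum, Hw|].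
  assert (0 <= q ^ n)%R by (apply pow_le; lra); nra. }
assert (HB0 : (0 <= B)%R).
{ unfold B; assert (0 <= M / (1 - q))%R; [|lra].
  apply Rmult_le_pos; [lra|]; apply Rlt_le, Rinv_0_lt_compat; lra. }
assert (Hx : (Cmod z / r < 1)%R).
{ apply Rmult_lt_reg_r with r; [lra|]; unfold Rdiv.
  rewrite Rmult_assoc, Rinv_l; lra. }
assert (Hx0 : (0 <= Cmod z / r)%R).
{ apply Rmult_le_pos; [lra|]; apply Rlt_le, Rinv_0_lt_compat; lra. }
assert (Hrem : forall n, (Cmod (psum c z n - f z) <= B * (Cmod z / r) ^ n)%R).
{ intros n.
  assert (H := proj1 (disc_germ_max n f c r B Hf ltac:(lra) (HB n)) z ltac:(lra)).
  replace (psum c z n - f z) with (- (f z - psum c z n)) by ring.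
  rewrite Cmod_opp.
  assert (Hrn : (0 < r ^ n)%R) by (apply pow_lt; lra).
  apply Rmult_le_reg_r with (r ^ n)%R; [exact Hrn|].
  rewrite Rmult_assoc, <- Rpow_mult_distr.
  replace (Cmod z / r * r)%R with (Cmod z) by (field; lra).
  exact H. }
apply is_pseries_psum; intros eps Heps.
destruct (pow_lt_1_zero (Cmod z / r) ltac:(rewrite Rabs_pos_eq; lra)
  (eps / (B + 1)) ltac:(apply Rdiv_lt_0_compat; lra)) as [N HN].
exists N; intros n Hn.
specialize (HN (S n) ltac:(lia)); rewrite Rabs_pos_eq in HN by now apply pow_le.
eapply Rle_lt_trans; [apply Hrem|].
assert (E : (eps / (B + 1) * (B + 1) = eps)%R) by (field; lra).
assert (0 <= (Cmod z / r) ^ S n)%R by now apply pow_le.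
nra.
Qed.

Theorem theorem9p1 (f : C -> C)
  (hf : analytic_on (Cdisc (RtoC 0) 1) f) :
  exists a : nat -> C,
    forall z : C, Cdisc (RtoC 0) 1 z -> is_pseries a z (f z).
Proof.
destruct hf as [_ H].
assert (D : forall z : C, Cdisc (RtoC 0) 1 z <-> (Cmod z < 1)%R).
{ intros z; unfold Cdisc; replace (z - 0) with z by ring; tauto. }
assert (L : forall z : C, (Cmod z < 1)%R -> exists c : nat -> C,
  near0 (fun h => is_pseries c h (f (z + h)))).
{ intros z Hz; destruct (H z (proj2 (D z) Hz)) as (r & c & Hr & _ & Hc).
  exists c, r; split; [exact Hr|]; intros h Hh.
  specialize (Hc (z + h)); unfold Cdisc in Hc.
  replace (z + h - z) with h in Hc by ring; auto. }
destruct (L 0) as [a Ha]; [rewrite Cmod_0; lra|].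
exists a; intros z Hz; apply (proj1 (D z)) in Hz.
apply disc_germ_series; [|exact Hz]; split.
- intros w Hw; destruct (L w Hw) as [c Hc]; exact (series_expands2 c f w Hc).
- revert Ha; apply near0_imp; intros h; rewrite Cplus_0_l; auto.
Qed.
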